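(* Let $G$ be an amenable topological group, let $X$ be a nonempty right $G$-space, and let $E$ be a Banach space. Let $\delta\ge 0$ be a real number and suppose that $h:G\to E^*$ and $f:X\to E^*$ are maps such that $f\in\mathbf{UC}(X;E^* )$ and $$\|f(xy)-f(x)-h(y)\|\leq\delta\qquad\text{for all }x\in X,\ y\in G.$$ Then there are maps $H:G\to E^*$ and $F:X\to E^*$ such that $H$ is continuous, $F\in\mathbf{UC}(X;E^* )$, and for all $x\in X$ and $y,z\in G$: $$H(yz)=H(y)+H(z),\qquad F(xy)=F(x)+H(y),\qquad \|H(y)-h(y)\|\leq\delta,\qquad \|F(x)-f(x)\|\leq2\delta.$$
   Context: Banach spaces are over $\mathbb{R}$; $E^*$ is the dual Banach space of $E$ with its norm topology. A right $G$-space is a topological space $X$ with a jointly continuous map $X\times G\to X$, $(x,y)\mapsto xy$, satisfying $xe=x$ and $x(yz)=(xy)z$, where $e$ is the identity of $G$. For a right $G$-space $X$ and a Banach space $B$ (here $B=E^*$): a function $f:X\to B$ is right uniform if for every $\epsilon>0$ there is an open neighborhood $U_\epsilon$ of $e$ in $G$ such that $\sup_{x\in X}\|f(xy)-f(x)\|<\epsilon$ for every $y\in U_\epsilon$; it is left uniform if for every $\epsilon>0$ and every $x\in X$ there is an open $V\subseteq X$ with $x\in V$ and $\sup_{y\in G}\|f(xy)-f(x'y)\|<\epsilon$ for every $x'\in V$. $\mathbf{UC}(X;B)$ is the space of continuous functions $X\to B$ that are both right uniform and left uniform. Amenability: let $\mathbf{LUCB}(G)$ be the space of bounded continuous real-valued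 functions $f$ on $G$ that are left uniform (for $G$ acting on itself by right multiplication), equivalently such that for every $\epsilon>0$ there is a neighborhood $U$ of $e$ with $\sup_{x\in G}|f(yx)-f(x)|<\epsilon$ for all $y\in U$. The topological group $G$ is amenable if there is a left invariant mean on $\mathbf{LUCB}(G)$, i.e. a bounded linear functional $m:\mathbf{LUCB}(G)\to\mathbb{R}$ (sup norm) with $m(1)=\|m\|=1$ and $m(x\mapsto f(yx))=m(f)$ for all $f\in\mathbf{LUCB}(G)$, $y\in G$. (Equivalently, via inversion, there is a right invariant mean on the space $\mathbf{RUCB}(G)$ of bounded continuous right uniform real functions on $G$.) *)

(* Defs.v *)
From HB Require Import structures.
From mathcomp Require Import all_boot all_order all_algebra.
From mathcomp Require Import all_classical all_reals all_analysis.
From mathcomp Require Import lra.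

Set Implicit Arguments.
Unset Strict Implicit.
Unset Printing Implicit Defensive.

Import Order.TTheory GRing.Theory Num.Theory.
Import numFieldNormedType.Exports.

Local Open Scope classical_set_scope.
Local Open Scope ring_scope.

HB.mixin Record TopologicalGroup_axioms G of Topological G & Group G := {
  mulg_continuous : continuous (fun p : G * G => (p.1 * p.2)%g) ;
  invg_continuous : continuous (fun x : G => (x^-1)%g)
}.

#[short(type="topologicalGroupType")]
HB.structure Definition TopologicalGroup :=
  {G of TopologicalGroup_axioms G & Topological G & Group G}.

Definition right_G_action (G : topologicalGroupType) (X : topologicalType)
    (act : X -> G -> X) : Prop :=
  [/\ continuous (fun p : X * G => act p.1 p.2),
      forall x, act x 1%g = x
    & forall x y z, act x (y * z)%g = act (act x y) z].

Lemma mulg_right_G_action (G : topologicalGroupType) :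
  right_G_action (fun x y : G => (x * y)%g).
Proof.
split; [exact: mulg_continuous | exact: mulg1 | exact: mulgA].
Qed.

Section uniform_functions.
Variables (R : realType) (G : topologicalGroupType) (X : topologicalType).
Variables (act : X -> G -> X) (B : normedModType R).
Implicit Type f : X -> B.

(* The suprema are taken in the extended reals: [sup] of an unbounded set of
   reals is 0. *)
Definition right_uniform f : Prop :=
  forall eps : R, 0 < eps -> exists U : set G, [/\ open U, U 1%g &
    forall y, U y ->
      (ereal_sup [set (`|f (act x y) - f x|)%:E | x in [set: X]] < eps%:E)%E].

Definition left_uniform f : Prop :=
  forall eps : R, 0 < eps -> forall x, exists V : set X, [/\ open V, V x &
    forall x', V x' ->
      (ereal_sup [set (`|f (act x y) - f (act x' y)|)%:E | y in [set: G]]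
         < eps%:E)%E].

Definition UC : set (X -> B) :=
  [set f | [/\ continuous f, right_uniform f & left_uniform f]].

Lemma ereal_sup_normP (I : Type) (F : I -> B) (d e : R) : d < e ->
  (forall i, `|F i| <= d) ->
  (ereal_sup [set (`|F i|)%:E | i in [set: I]] < e%:E)%E.
Proof.
move=> de Fd; apply: (@le_lt_trans _ _ d%:E); last by rewrite lte_fin.
by apply: ge_ereal_sup => _ [i _ <-]; rewrite lee_fin.
Qed.

Lemma ereal_sup_norm_lt (I : Type) (F : I -> B) (e : R) (i : I) :
  (ereal_sup [set (`|F i|)%:E | i in [set: I]] < e%:E)%E -> `|F i| < e.
Proof.
move=> Fe; rewrite -lte_fin; apply: le_lt_trans Fe.
by apply: ereal_sup_ubound; exists i.
Qed.

Lemma left_uniform_cst (b : B) : left_uniform (fun=> b).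
Proof.
move=> e e0 x; exists setT; split => // [|x' _]; first exact: openT.
by apply: (@ereal_sup_normP _ _ 0) => // i; rewrite subrr normr0.
Qed.

Lemma left_uniform_linear (a : R) f g :
  left_uniform f -> left_uniform g -> left_uniform (fun x => a *: f x + g x).
Proof.
move=> lf lg e e0 x.
have a0 : 0 < `|a| + 1 by rewrite ltr_wpDl.
have e3 : 0 < e / 3 by rewrite divr_gt0.
have [V [oV Vx fV]] := lf (e / 3 / (`|a| + 1)) (divr_gt0 e3 a0) x.
have [W [oW Wx gW]] := lg _ e3 x.
exists (V `&` W); split; [exact: openI|by []|move=> x' [Vx' Wx']].
apply: (@ereal_sup_normP _ _ (e / 3 + e / 3)); first lra.
move=> y; have /ltW f1 := ereal_sup_norm_lt y (fV _ Vx').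
have /ltW g1 := ereal_sup_norm_lt y (gW _ Wx').
rewrite opprD addrACA -scalerBr; apply: le_trans (ler_normD _ _) _.
apply: lerD => //; rewrite normrZ.
apply: (@le_trans _ _ ((`|a| + 1) * (e / 3 / (`|a| + 1)))).
  by apply: ler_pM => //; rewrite lerDl.
by rewrite mulrC divfK// gt_eqF.
Qed.

End uniform_functions.

Section sup_norm.
Variables (R : realType) (T : Type) (A : set T).
Implicit Type f g : T -> R.

Definition sup_norm f : R := sup [set `|f x| | x in A].

Lemma sup_norm_ub f x : (exists M, forall y, A y -> `|f y| <= M) -> A x ->
  `|f x| <= sup_norm f.
Proof.
move=> [M fM] Ax; apply: ub_le_sup; last by exists x.
by exists M => _ [y Ay <-]; exact: fM.
Qed.

Lemma sup_norm_le f M : A !=set0 -> (forall y, A y -> `|f y| <= M) ->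
  sup_norm f <= M.
Proof.
move=> [x Ax] fM; apply: ge_sup; first by exists `|f x|, x.
by move=> _ [y Ay <-]; exact: fM.
Qed.

Lemma sup_normD f g : A !=set0 ->
  (exists M, forall y, A y -> `|f y| <= M) ->
  (exists M, forall y, A y -> `|g y| <= M) ->
  sup_norm (fun x => f x + g x) <= sup_norm f + sup_norm g.
Proof.
move=> A0 bf bg; apply: sup_norm_le => // y Ay.
by apply: le_trans (ler_normD _ _) _; apply: lerD; exact: sup_norm_ub.
Qed.

Lemma sup_normZ (l : R) f : A !=set0 ->
  (exists M, forall y, A y -> `|f y| <= M) ->
  sup_norm (fun x => l * f x) = `|l| * sup_norm f.
Proof.
move=> A0 bf; have leZ (k : R) g : (exists M, forall y, A y -> `|g y| <= M) ->
    sup_norm (fun x => k * g x) <= `|k| * sup_norm g.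
  move=> bg; apply: sup_norm_le => // y Ay.
  by rewrite normrM ler_wpM2l//; exact: sup_norm_ub.
apply/eqP; rewrite eq_le leZ//=.
have [->|l0] := eqVneq l 0.
  rewrite normr0 mul0r; have [x Ax] := A0.
  apply: (@le_trans _ _ `|0 * f x|); first exact: normr_ge0.
  apply: (@sup_norm_ub (fun x => 0 * f x)) => //.
  by exists 0 => y _; rewrite mul0r normr0.
have bl : exists M, forall y, A y -> `|l * f y| <= M.
  have [M fM] := bf; exists (`|l| * M) => y Ay.
  by rewrite normrM ler_wpM2l// fM.
rewrite -ler_pdivlMl ?normr_gt0// -normfV.
apply: le_trans (leZ l^-1 _ bl); rewrite le_eqVlt; apply/orP; left.
by apply/eqP; congr sup_norm; apply/funext => x; rewrite mulKf.
Qed.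

End sup_norm.

Section dual.
Variables (R : realType) (E : normedModType R).

Definition dual_pred : {pred E -> R} :=
  mem [set f : E -> R | linear f /\ continuous f].

Record dual := Dual { dual_fun :> E -> R ; _ : dual_fun \in dual_pred }.

HB.instance Definition _ := [isSub for dual_fun].
HB.instance Definition _ := [Choice of dual by <:].

Lemma dual_pred_submod : GRing.submod_closed dual_pred.
Proof.
split; first by rewrite inE; split; [move=> a u v /=; rewrite scaler0 addr0|
  exact: cst_continuous].
move=> a f g; rewrite !inE => -[lf cf] [lg cg]; split.
  move=> b u v; rewrite !fctE/= lf lg !scalerDr addrACA; congr (_ + _).
  by rewrite !scalerA mulrC.
by move=> x; apply: cvgD; [apply: cvgZl_tmp; exact: cf|exact: cg].
Qed.

HB.instance Definition _ :=
  GRing.isSubmodClosed.Build R (E -> R) dual_pred dual_pred_submod.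
HB.instance Definition _ := [SubChoice_isSubLmodule of dual by <:].

Definition dual_norm (phi : dual) : R := sup_norm [set x : E | `|x| <= 1] phi.

Lemma dual_linear (phi : dual) : linear phi.
Proof. by case: phi => f /=; rewrite inE => -[]. Qed.

Lemma dual_continuous (phi : dual) : continuous phi.
Proof. by case: phi => f /=; rewrite inE => -[]. Qed.

HB.instance Definition _ (phi : dual) :=
  GRing.isLinear.Build R E R *:%R phi (@dual_linear phi).

Let ball0 : [set x : E | `|x| <= 1] !=set0.
Proof. by exists 0; rewrite /= normr0. Qed.

Lemma dual_bounded (phi : dual) :
  exists M, forall x, `|x| <= 1 -> `|phi x| <= M.
Proof.
have /linear_bounded_continuous/bounded_funP := @dual_continuous phi.
exact.
Qed.

Lemma dual_normD (phi psi : dual) :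
  dual_norm (phi + psi) <= dual_norm phi + dual_norm psi.
Proof. by apply: sup_normD => //; exact: dual_bounded. Qed.

Lemma dual_normZ (l : R) (phi : dual) :
  dual_norm (l *: phi) = `|l| * dual_norm phi.
Proof. by apply: sup_normZ => //; exact: dual_bounded. Qed.

Lemma dual_norm0_eq0 (phi : dual) : dual_norm phi = 0 -> phi = 0.
Proof.
move=> phi0; apply/val_inj/funext => x /=.
have [->|x0] := eqVneq x 0; first exact: (linear0 (phi : {linear E -> R})).
have : `|phi (`|x|^-1 *: x)| <= 0.
  rewrite -phi0; apply: sup_norm_ub; first exact: dual_bounded.
  by rewrite /= normrZ normfV normr_id mulVf ?normr_eq0.
rewrite normr_le0 linearZ/= scaler_eq0 invr_eq0 normr_eq0 (negbTE x0)/=.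
by move=> /eqP.
Qed.

HB.instance Definition _ :=
  Lmodule_isNormed.Build R dual dual_normD dual_normZ dual_norm0_eq0.

Lemma dual_normE (phi : dual) :
  `|phi| = sup [set `|phi x| | x in [set x : E | `|x| <= 1]].
Proof. by []. Qed.

End dual.

Section LUCB.
Variables (R : realType) (G : topologicalGroupType).

Definition LUCB_pred : {pred G -> R} :=
  mem [set f : G -> R | [/\ bounded_fun f, continuous f &
    left_uniform (fun x y : G => (x * y)%g) f]].

Record LUCB := MkLUCB { LUCB_fun :> G -> R ; _ : LUCB_fun \in LUCB_pred }.

HB.instance Definition _ := [isSub for LUCB_fun].
HB.instance Definition _ := [Choice of LUCB by <:].

Lemma bounded_funE (f : G -> R) :
  bounded_fun f <-> exists M, forall x, [set: G] x -> `|f x| <= M.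
Proof.
split=> [/pinfty_ex_gt0[M _ fM]|[M fM]]; first by exists M => x _; exact: fM.
have GF : ProperFilter (globally [set: G]) by apply: (@globally_properfilter _ _ 1%g).
by apply/(@ex_bound G R R f _ GF); exists M => x _; exact: fM.
Qed.

Lemma cst_LUCB (c : R) : (fun=> c) \in LUCB_pred.
Proof.
rewrite inE; split; [|exact: cst_continuous|exact: left_uniform_cst].
by apply/bounded_funE; exists `|c|.
Qed.

Lemma LUCB_pred_submod : GRing.submod_closed LUCB_pred.
Proof.
split; first exact: cst_LUCB.
move=> a f g; rewrite !inE => -[bf cf lf] [bg cg lg]; split.
- move/bounded_funE : bf => [M fM]; move/bounded_funE : bg => [N gN].
  apply/bounded_funE; exists (`|a| * M + N) => x Gx.
  apply: le_trans (ler_normD _ _) _; apply: lerD; last exact: gN.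
  by rewrite normrZ ler_wpM2l// fM.
- by move=> x; apply: cvgD; [apply: cvgZl_tmp; exact: cf|exact: cg].
- exact: left_uniform_linear.
Qed.

HB.instance Definition _ :=
  GRing.isSubmodClosed.Build R (G -> R) LUCB_pred LUCB_pred_submod.
HB.instance Definition _ := [SubChoice_isSubLmodule of LUCB by <:].

Definition LUCB_norm (f : LUCB) : R := sup_norm [set: G] f.

Let G0 : [set: G] !=set0. Proof. by exists 1%g. Qed.

Lemma LUCB_bounded (f : LUCB) : exists M, forall x, [set: G] x -> `|f x| <= M.
Proof. by case: f => f /=; rewrite inE => -[/bounded_funE]. Qed.

Lemma LUCB_normD (f g : LUCB) : LUCB_norm (f + g) <= LUCB_norm f + LUCB_norm g.
Proof. by apply: sup_normD => //; exact: LUCB_bounded. Qed.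

Lemma LUCB_normZ (l : R) (f : LUCB) : LUCB_norm (l *: f) = `|l| * LUCB_norm f.
Proof. by apply: sup_normZ => //; exact: LUCB_bounded. Qed.

Lemma LUCB_norm0_eq0 (f : LUCB) : LUCB_norm f = 0 -> f = 0.
Proof.
move=> f0; apply/val_inj/funext => x /=; apply/eqP; rewrite -normr_le0 -f0.
by apply: sup_norm_ub => //; exact: LUCB_bounded.
Qed.

HB.instance Definition _ :=
  Lmodule_isNormed.Build R LUCB LUCB_normD LUCB_normZ LUCB_norm0_eq0.

Lemma LUCB_normE (f : LUCB) : `|f| = sup [set `|f x| | x in [set: G]].
Proof. by []. Qed.

Definition LUCB_cst (c : R) : LUCB := MkLUCB (cst_LUCB c).

Lemma LUCB_lmul_subproof (y : G) (f : LUCB) :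
  (fun x => f (y * x)%g) \in LUCB_pred.
Proof.
case: f => f /=; rewrite !inE => -[bf cf lf].
have cy : continuous (fun x : G => (y * x)%g).
  move=> x; apply: (@continuous_comp _ _ _ (fun x => (y, x))
    (fun p : G * G => (p.1 * p.2)%g)); last exact: mulg_continuous.
  by apply: cvg_pair => /=; [exact: cvg_cst|exact: cvg_id].
split.
- move/bounded_funE : bf => [M fM]; apply/bounded_funE.
  by exists M => x _; exact: fM.
- by move=> x; apply: continuous_comp; [exact: cy|exact: cf].
- move=> e e0 x; have [V [oV Vx fV]] := lf e e0 (y * x)%g.
  exists ((fun x => y * x)%g @^-1` V); split => //.
    by apply: open_comp => // z _; exact: cy.
  by move=> x' /fV; under eq_imagel do rewrite -!mulgA.
Qed.

Definition LUCB_lmul (y : G) (f : LUCB) : LUCB :=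
  MkLUCB (LUCB_lmul_subproof y f).

(* A bounded linear functional is an element of the dual; its norm is the
   operator norm for the sup norm on [LUCB]. *)
Definition left_invariant_mean (m : dual LUCB) : Prop :=
  [/\ m (LUCB_cst 1) = 1, `|m| = 1 & forall f y, m (LUCB_lmul y f) = m f].

Definition amenable : Prop := exists m, left_invariant_mean m.

End LUCB.

(* Main.v *)
(* Pairing with points of [E] turns a left invariant mean [m] into a mean [M] of
   bounded left uniform maps [G -> E^*].  For a base point [x0], the map
   [H y = M_w (f (x0 w^-1 y) - f (x0 w^-1))] averages quantities within [delta]
   of [h y]; inverting [w] makes the integrand left uniform and turns left
   invariance of [M] into right invariance, so [H (y z) = H y + H z].  Then
   [F x = M_w (f (x w) - H w)] averages quantities within [2 delta] of [f x],
   and left invariance gives [F (x y) = F x + H y]. *)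
Require Import Defs.
From HB Require Import structures.
From mathcomp Require Import all_boot all_order all_algebra.
From mathcomp Require Import all_classical all_reals all_analysis.

Set Implicit Arguments.
Unset Strict Implicit.
Unset Printing Implicit Defensive.

Import Order.TTheory GRing.Theory Num.Theory.
Import numFieldNormedType.Exports.

Local Open Scope classical_set_scope.
Local Open Scope ring_scope.

(** * Uniformity in terms of neighbourhood filters *)

Section uniform_near.
Variables (R : realType) (G : topologicalGroupType) (X : topologicalType).
Variables (act : X -> G -> X) (B : normedModType R).
Implicit Types f g : X -> B.

Lemma right_uniformP f : right_uniform act f <->
  forall e, 0 < e -> \forall u \near 1%g, forall x, `|f (act x u) - f x| <= e.
Proof.
split=> [rf e e0|rf e e0].
  have [U [oU U1 fU]] := rf e e0.
  apply: filterS (open_nbhs_nbhs (conj oU U1)) => u /fU fu x.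
  exact: ltW (ereal_sup_norm_lt x fu).
(* Halving [e] restores the strict inequality that is lost in passing from pointwise bounds to the
   supremum. *)
have e2 : 0 < e / 2 by rewrite divr_gt0.
have := rf _ e2; rewrite -nbhs_nearE nbhsE => -[U [oU U1] fU].
exists U; split => // u /fU fu; apply: (ereal_sup_normP _ fu).
by rewrite ltr_pdivrMr// ltr_pMr// ltr1n.
Qed.

Lemma left_uniformP f : left_uniform act f <->
  forall e, 0 < e -> forall x, \forall x' \near x,
    forall y, `|f (act x y) - f (act x' y)| <= e.
Proof.
split=> [lf e e0 x|lf e e0 x].
  have [V [oV Vx fV]] := lf e e0 x.
  apply: filterS (open_nbhs_nbhs (conj oV Vx)) => x' /fV fx' y.
  exact: ltW (ereal_sup_norm_lt y fx').
have e2 : 0 < e / 2 by rewrite divr_gt0.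
have := lf _ e2 x; rewrite -nbhs_nearE nbhsE => -[V [oV Vx] fV].
exists V; split => // x' /fV fx'; apply: (ereal_sup_normP _ fx').
by rewrite ltr_pdivrMr// ltr_pMr// ltr1n.
Qed.

Lemma left_uniform_continuous f :
  (forall x, act x 1%g = x) -> left_uniform act f -> continuous f.
Proof.
move=> act1 /left_uniformP lf x; apply/cvgrPdist_le => e e0.
by apply: filterS (lf e e0 x) => x' /(_ 1%g); rewrite !act1.
Qed.

Lemma left_uniformB f g :
  left_uniform act f -> left_uniform act g ->
  left_uniform act (fun x => f x - g x).
Proof.
move=> lf lg; have -> : (fun x => f x - g x) = (fun x => -1 *: g x + f x).
  by apply/funext => x; rewrite scaleN1r addrC.
exact: left_uniform_linear.
Qed.

End uniform_near.

(** * Left uniformity on [G] of maps along orbits and of additive maps *)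

Section orbit_maps.
Variables (R : realType) (G : topologicalGroupType) (X : topologicalType).
Variables (act : X -> G -> X) (act_action : right_G_action act).
Variable B : normedModType R.

Lemma cvg_mulg (T : topologicalType) (F : set_system T) (FF : Filter F)
    (a b : T -> G) (x y : G) :
  a @ F --> x -> b @ F --> y -> (a t * b t)%g @[t --> F] --> (x * y)%g.
Proof.
exact: (continuous2_cvg FF (h := fun x y : G => (x * y)%g)
  (@mulg_continuous G (x, y))).
Qed.

Lemma left_uniform_orbit (f : X -> B) (x : X) : left_uniform act f ->
  left_uniform (fun w y : G => (w * y)%g) (fun w => f (act x w)).
Proof.
have [cact _ actM] := act_action.
move=> /left_uniformP lf; apply/left_uniformP => e e0 w.
have actxw : act x w' @[w' --> w] --> act x w.
  exact: (continuous2_cvg (nbhs_filter w) (cact (x, w)) (cvg_cst x) cvg_id).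
apply: (@filterS _ (nbhs w) _ _ _ _ (actxw _ (lf e e0 (act x w)))) => w' fw' y.
by rewrite !actM.
Qed.

(* With [v = (w' z)^-1 y] one has [(w z)^-1 y = v (y^-1 w' w^-1 y)], so that
   right uniformity of [f] applies at the point [x v]. *)
Lemma left_uniform_inv_orbit (f : X -> B) (x : X) (y : G) :
  right_uniform act f ->
  left_uniform (fun w z : G => (w * z)%g) (fun w => f (act x (w^-1 * y)%g)).
Proof.
have [_ _ actM] := act_action.
move=> /right_uniformP rf; apply/left_uniformP => e e0 w.
have conjw : (y^-1 * w' * (w^-1 * y))%g @[w' --> w] --> (1%g : G).
  have -> : 1%g = (y^-1 * w * (w^-1 * y))%g :> G by rewrite mulgA mulgK mulVg.
  apply: cvg_mulg; last exact: cvg_cst.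
  by apply: cvg_mulg; [exact: cvg_cst|exact: cvg_id].
apply: (@filterS _ (nbhs w) _ _ _ _ (conjw _ (rf e e0))) => w' fw' z.
have := fw' (act x ((w' * z)^-1 * y)%g); rewrite -actM; congr (_ <= _).
by congr (`|f (act x _) - _|); rewrite !invgM !mulgA mulgK mulgVK.
Qed.

(** With [w' = w u], additivity gives [H (w y) - H (w' y) = - H u] for every [y], so smallness near
    the identity suffices. *)
Lemma additive_left_uniform (H : G -> B) :
  (forall y z, H (y * z)%g = H y + H z) ->
  (forall e, 0 < e -> \forall u \near 1%g, `|H u| <= e) ->
  left_uniform (fun w y : G => (w * y)%g) H.
Proof.
move=> HM H1; apply/left_uniformP => e e0 w.
have w1 : (w^-1 * w')%g @[w' --> w] --> (1%g : G).
  rewrite -(mulVg w).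
  by apply: cvg_mulg; [exact: cvg_cst|exact: cvg_id].
apply: (@filterS _ (nbhs w) _ _ _ _ (w1 _ (H1 e e0))) => w' /= Hw' y.
rewrite -(mulVKg w w'); move: (w^-1 * w')%g Hw' => u Hu.
by rewrite !HM opprD addrACA subrr addr0 opprD addrA subrr sub0r normrN.
Qed.

End orbit_maps.

(** * Operator norm estimates in the dual *)

Lemma dual_ler_norm (R : realType) (E : normedModType R) (phi : dual E)
    (v : E) : `|phi v| <= `|phi| * `|v|.
Proof.
have [->|v0] := eqVneq v 0.
  by rewrite (linear0 (phi : {linear E -> R})) !normr0 mulr0.
have v1 : `|(`|v|^-1 *: v)| <= 1.
  by rewrite normrZ normfV normr_id mulVf ?normr_eq0.
have /= := sup_norm_ub (dual_bounded phi) v1.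
rewrite -/(dual_norm phi) linearZ/= normrM normfV normr_id mulrC.
by rewrite ler_pdivrMr ?normr_gt0.
Qed.

Lemma dual_norm_le (R : realType) (E : normedModType R) (phi : dual E)
    (d : R) : 0 <= d -> (forall v, `|phi v| <= d * `|v|) -> `|phi| <= d.
Proof.
move=> d0 phid; apply: sup_norm_le; first by exists 0; rewrite /= normr0.
by move=> v /= v1; apply: le_trans (phid v) _; rewrite ler_piMr.
Qed.

Lemma bounded_linear_dual (R : realType) (E : normedModType R) (g : E -> R)
    (d : R) :
  linear g -> (forall v, `|g v| <= d * `|v|) -> g \in @dual_pred R E.
Proof.
move=> lg gd; rewrite inE; split => //.
pose gL := GRing.isLinear.Build R E R *:%R g lg.
pose g' : {linear E -> R} := HB.pack g gL.
have : bounded_near g' (nbhs (0 : E)).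
  (* The absolute value is there because [d] carries no sign assumption. *)
  apply/bounded_funP => r; exists (`|d| * r) => v vr.
  apply: le_trans (gd v) _; apply: (@le_trans _ _ (`|d| * `|v|)).
    by rewrite ler_wpM2r// ler_norm.
  by rewrite ler_wpM2l.
by move=> /linear_bounded_continuous.
Qed.

(** * Means of dual-valued maps, computed weakly against vectors of [E] *)

Section vector_mean.
Variables (R : realType) (G : topologicalGroupType) (E : normedModType R).
Implicit Types Phi Psi : G -> dual E.

Definition bounded_left_uniform Phi : Prop :=
  (exists K, forall w, `|Phi w| <= K) /\
  left_uniform (fun x y : G => (x * y)%g) Phi.

Lemma bounded_left_uniform_linear (a : R) Phi Psi :
  bounded_left_uniform Phi -> bounded_left_uniform Psi ->
  bounded_left_uniform (fun w => a *: Phi w + Psi w).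
Proof.
move=> [[K PhiK] lPhi] [[L PsiL] lPsi]; split; last exact: left_uniform_linear.
exists (`|a| * K + L) => w; apply: le_trans (ler_normD _ _) _.
by rewrite lerD// normrZ ler_wpM2l.
Qed.

Lemma bounded_left_uniform_cst (phi : dual E) :
  bounded_left_uniform (fun=> phi).
Proof. by split; [by exists (`|phi|)|exact: left_uniform_cst]. Qed.

Lemma bounded_left_uniform_lmul Phi (y : G) : bounded_left_uniform Phi ->
  bounded_left_uniform (fun w => Phi (y * w)%g).
Proof.
move=> [[K PhiK] /left_uniformP lPhi]; split; first by exists K.
apply/left_uniformP => e e0 w.
have yw : (y * w')%g @[w' --> w] --> (y * w)%g.
  by apply: cvg_mulg; [exact: cvg_cst|exact: cvg_id].
apply: (@filterS _ (nbhs w) _ _ _ _ (yw _ (lPhi e e0 (y * w)%g))) => w' + z.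
by move=> /(_ z); rewrite !mulgA.
Qed.

Lemma bounded_left_uniform_LUCB Phi (v : E) : bounded_left_uniform Phi ->
  (fun w => Phi w v) \in @LUCB_pred R G.
Proof.
move=> [[K PhiK] /left_uniformP lPhi].
have lv : left_uniform (fun x y : G => (x * y)%g) (fun w => Phi w v).
  (* Dividing [e] by [|v| + 1] instead of [|v|] covers [v = 0]. *)
  apply/left_uniformP => e e0 x; have v0 : 0 < `|v| + 1 by rewrite ltr_wpDl.
  apply: filterS (lPhi _ (divr_gt0 e0 v0) x) => x' Pxx' y.
  apply: le_trans (dual_ler_norm (Phi (x * y)%g - Phi (x' * y)%g) v) _.
  have := Pxx' y; rewrite ler_pdivlMr//; apply: le_trans.
  by rewrite ler_wpM2l// lerDl.
rewrite inE; split => //.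
  apply/bounded_funE; exists (K * `|v|) => w _.
  by apply: le_trans (dual_ler_norm _ _) _; rewrite ler_wpM2r.
exact: left_uniform_continuous (@mulg1 G) lv.
Qed.

Variable m : dual (LUCB R G).

(* Both uses of [insubd] fall back on the junk value [0] when the map is not
   [bounded_left_uniform]. *)
Definition vector_mean Phi : dual E :=
  insubd 0 (fun v => m (insubd 0 (fun w => Phi w v))).

(** Ensures that the outer [insubd] of [vector_mean] does not fall back on [0]: since [m] has norm
    1, a bound [K] of [Phi] also bounds the functional. *)
Lemma vector_mean_subproof Phi : `|m| = 1 -> bounded_left_uniform Phi ->
  (fun v => m (insubd 0 (fun w => Phi w v))) \in @dual_pred R E.
Proof.
move=> m1 bPhi; have [[K PhiK] _] := bPhi.
apply: (@bounded_linear_dual _ _ _ K) => [a u v|v].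
  rewrite -(linearP (m : {linear _ -> _})); congr (m _).
  apply/val_inj/funext => w.
  rewrite /= !insubdK ?bounded_left_uniform_LUCB//.
  exact: (linearP (Phi w : {linear E -> R})).
apply: le_trans (dual_ler_norm _ _) _; rewrite m1 mul1r.
apply: sup_norm_le; first by exists 1%g.
move=> w _; rewrite insubdK ?bounded_left_uniform_LUCB//.
by apply: le_trans (dual_ler_norm _ _) _; rewrite ler_wpM2r.
Qed.

Hypothesis m_mean : left_invariant_mean m.

(** Removes both [insubd] at once; the properties of [m] then transfer to [vector_mean] by choosing
    a suitable [g]. *)
Lemma vector_meanE Phi (v : E) (g : LUCB R G) : bounded_left_uniform Phi ->
  (forall w, g w = Phi w v) -> vector_mean Phi v = m g.
Proof.
move=> bPhi gE; have [_ m1 _] := m_mean.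
rewrite /vector_mean (insubdK 0 (vector_mean_subproof m1 bPhi)).
congr (m _); apply/val_inj/funext => w.
by rewrite /= insubdK ?bounded_left_uniform_LUCB.
Qed.

Lemma vector_mean_linear (a : R) Phi Psi :
  bounded_left_uniform Phi -> bounded_left_uniform Psi ->
  vector_mean (fun w => a *: Phi w + Psi w) =
  a *: vector_mean Phi + vector_mean Psi.
Proof.
move=> bPhi bPsi; apply/val_inj/funext => v /=.
rewrite !fctE/=.
rewrite (@vector_meanE _ v (MkLUCB (bounded_left_uniform_LUCB v bPhi)) bPhi)//.
rewrite (@vector_meanE _ v (MkLUCB (bounded_left_uniform_LUCB v bPsi)) bPsi)//.
rewrite -(linearP (m : {linear _ -> _})); apply: vector_meanE => //.
exact: bounded_left_uniform_linear.
Qed.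

Lemma vector_mean_cst (phi : dual E) : vector_mean (fun=> phi) = phi.
Proof.
have [m1 _ _] := m_mean; apply/val_inj/funext => v /=.
rewrite (@vector_meanE _ v (phi v *: LUCB_cst G 1)).
- by rewrite linearZ/= m1; exact: mulr1.
- exact: bounded_left_uniform_cst.
- by move=> w; exact: mulr1.
Qed.

Lemma vector_mean_norm Phi (d : R) : bounded_left_uniform Phi ->
  (forall w, `|Phi w| <= d) -> `|vector_mean Phi| <= d.
Proof.
move=> bPhi Phid; have [_ m1 _] := m_mean.
apply: dual_norm_le; first exact: le_trans (Phid 1%g).
move=> v.
rewrite (@vector_meanE _ v (MkLUCB (bounded_left_uniform_LUCB v bPhi)) bPhi)//.
apply: le_trans (dual_ler_norm _ _) _; rewrite m1 mul1r.
apply: sup_norm_le => [|w _]; first by exists 1%g.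
by apply: le_trans (dual_ler_norm _ _) _; rewrite ler_wpM2r.
Qed.

Lemma vector_mean_lmul Phi (y : G) : bounded_left_uniform Phi ->
  vector_mean (fun w => Phi (y * w)%g) = vector_mean Phi.
Proof.
move=> bPhi; have [_ _ mL] := m_mean; apply/val_inj/funext => v /=.
have byPhi := bounded_left_uniform_lmul y bPhi.
pose g : LUCB R G := MkLUCB (bounded_left_uniform_LUCB v bPhi).
rewrite (@vector_meanE Phi v g)// -(mL g y).
exact: vector_meanE.
Qed.

Lemma vector_meanD Phi Psi :
  bounded_left_uniform Phi -> bounded_left_uniform Psi ->
  vector_mean (fun w => Phi w + Psi w) = vector_mean Phi + vector_mean Psi.
Proof.
move=> bPhi bPsi; have := vector_mean_linear 1 bPhi bPsi.
rewrite scale1r => <-.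
by congr vector_mean; apply/funext => w; rewrite scale1r.
Qed.

Lemma vector_meanB Phi Psi :
  bounded_left_uniform Phi -> bounded_left_uniform Psi ->
  vector_mean (fun w => Phi w - Psi w) = vector_mean Phi - vector_mean Psi.
Proof.
move=> bPhi bPsi; have := vector_mean_linear (-1) bPsi bPhi.
rewrite scaleN1r [RHS]addrC => <-.
by congr vector_mean; apply/funext => w; rewrite scaleN1r addrC.
Qed.

Lemma vector_mean_dist Phi Psi (d : R) :
  bounded_left_uniform Phi -> bounded_left_uniform Psi ->
  (forall w, `|Phi w - Psi w| <= d) ->
  `|vector_mean Phi - vector_mean Psi| <= d.
Proof.
move=> bPhi bPsi dPP; rewrite -vector_meanB//; apply: vector_mean_norm => //.
have -> : (fun w => Phi w - Psi w) = (fun w => -1 *: Psi w + Phi w).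
  by apply/funext => w; rewrite scaleN1r addrC.
exact: bounded_left_uniform_linear.
Qed.

End vector_mean.

(** * Construction of [H] and [F], with their uniformity and bounds *)

Theorem theorem4p3 (R : realType) (G : topologicalGroupType)
    (G_amenable : amenable R G)
    (X : topologicalType) (act : X -> G -> X)
    (act_action : right_G_action act) (X_nonempty : [set: X] !=set0)
    (E : completeNormedModType R) (delta : R) (delta_ge0 : 0 <= delta)
    (h : G -> dual E) (f : X -> dual E) (f_UC : UC act f)
    (hf : forall x y, `|f (act x y) - f x - h y| <= delta) :
  exists (H : G -> dual E) (F : X -> dual E),
    [/\ continuous H, UC act F &
        forall (x : X) (y z : G),
          [/\ H (y * z)%g = H y + H z,
              F (act x y) = F x + H y,
              `|H y - h y| <= delta
            & `|F x - f x| <= 2 * delta]].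
Proof.
have [m mm] := G_amenable; have [x0 _] := X_nonempty.
have [_ act1 actM] := act_action; have [_ rf lf] := f_UC.
(* The increment of [f] from the point [x0 w^-1] along [y], hence within [delta] of [h y]. *)
pose D y w := f (act x0 (w^-1 * y)%g) - f (act x0 w^-1%g).
have Dact y w : D y w = f (act (act x0 w^-1%g) y) - f (act x0 w^-1%g).
  by rewrite /D actM.
have bD y : bounded_left_uniform (D y).
  split.
    exists (delta + `|h y|) => w.
    by rewrite -[D y w](subrK (h y)) (le_trans (ler_normD _ _))// lerD2r Dact.
  apply: left_uniformB; first exact: (left_uniform_inv_orbit act_action _ _ rf).
  (* The subtracted term is the case [y = 1] of the same orbit lemma. *)
  have <- : (fun w => f (act x0 (w^-1 * 1)%g)) = (fun w => f (act x0 w^-1%g)).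
    by apply/funext => w; rewrite mulg1.
  exact: (left_uniform_inv_orbit act_action _ _ rf).
pose H y := vector_mean m (D y).
have HM y z : H (y * z)%g = H y + H z.
  (* As [(y^-1 w)^-1 = w^-1 y], the sum [D y w + D z (y^-1 w)] telescopes to [D (y z) w]. *)
  have bDy := bounded_left_uniform_lmul y^-1%g (bD z).
  rewrite addrC /H -(vector_mean_lmul mm y^-1%g (bD z)).
  rewrite -(vector_meanD mm bDy (bD y)).
  congr vector_mean; apply/funext => w.
  by rewrite /D invgM invgK -mulgA addrA subrK.
have Hh y : `|H y - h y| <= delta.
  rewrite -(vector_mean_cst mm (h y)).
  apply: vector_mean_dist => // [|w]; first exact: bounded_left_uniform_cst.
  by rewrite Dact.
(* Right uniformity of [f] bounds [D u w] uniformly in [w] for [u] near the identity. *)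
have H1 e : 0 < e -> \forall u \near 1%g, `|H u| <= e.
  move=> e0; move/right_uniformP: (rf) => /(_ _ e0); apply: filterS => u fu.
  by apply: vector_mean_norm => // w; rewrite Dact.
have lH := additive_left_uniform HM H1.
(* Both terms may be unbounded in [w], but each follows [h w] up to a bounded error, so the
   difference can be averaged. *)
pose K x w := f (act x w) - H w.
have Kf x w : `|K x w - f x| <= 2 * delta.
  have -> : K x w - f x = (f (act x w) - f x - h w) - (H w - h w).
    by rewrite opprB addrA subrK addrAC.
  by rewrite mulr_natl mulr2n (le_trans (ler_normB _ _))// lerD.
have bK x : bounded_left_uniform (K x).
  split.
    exists (2 * delta + `|f x|) => w.
    by rewrite -[K x w](subrK (f x)) (le_trans (ler_normD _ _))// lerD2r.
  apply: left_uniformB => //; exact: (left_uniform_orbit act_action _ lf).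
pose F x := vector_mean m (K x).
have FM x y : F (act x y) = F x + H y.
  (* Additivity of [H] gives [K (x y) w = K x (y w) + H y], where [H y] is constant in [w]. *)
  have bKy := bounded_left_uniform_lmul y (bK x).
  rewrite /F -(vector_mean_lmul mm y (bK x)) -(vector_mean_cst mm (H y)).
  rewrite -(vector_meanD mm bKy (bounded_left_uniform_cst G (H y))).
  congr vector_mean; apply/funext => w.
  by rewrite /K HM actM opprD addrAC addrA addrK.
have lF : left_uniform act F.
  apply/left_uniformP => e e0 x; move/left_uniformP: (lf) => /(_ _ e0 x).
  apply: filterS => x' fx' y.
  (* First [H y] cancels, then [H w] under the mean, leaving [f (x w) - f (x' w)], which is small
     uniformly in [w]. *)
  rewrite (FM x) (FM x') opprD addrACA (subrr (H y)) addr0.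
  apply: vector_mean_dist => // w.
  by rewrite /K opprB addrA subrK.
exists H, F; split => [||x y z].
- exact: left_uniform_continuous (@mulg1 G) lH.
- split => //; first exact: left_uniform_continuous lF.
  (* Here [F (x u) - F x = H u], whatever [x] is. *)
  apply/right_uniformP => e /H1; apply: filterS => u Hu x.
  by rewrite FM addrAC subrr add0r.
- split => //; rewrite -(vector_mean_cst mm (f x)).
  apply: vector_mean_dist => //; exact: bounded_left_uniform_cst.
Qed.
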